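(* Let $\mathcal V$ be a symmetric monoidal closed category, let $\mathbb T=(T,\eta,\mu)$ be a $\mathcal V$-monad on a $\mathcal V$-category $\mathcal B$, and let $F\dashv G:\mathcal C\to\mathcal B$ be any $\mathcal V$-adjunction inducing $\mathbb T$. Then the following are equivalent: (1) The idempotent core of $\mathbb T$ exists. (2) The terminal idempotent $\mathcal V$-monad over $\mathbb T$ exists, and its underlying endofunctor inverts the same morphisms as $T$. (3) $\mathcal B_{\Sigma_T}$ is a $\mathcal V$-reflective-subcategory of $\mathcal B$. (4) $F\dashv G$ factors through a $\mathcal V$-reflection $K\dashv J:\mathcal B'\hookrightarrow\mathcal B$ in such a way that the induced left $\mathcal V$-adjoint $F':\mathcal B'\to\mathcal C$ is conservative (i.e. reflects isomorphisms). Further, given an idempotent $\mathcal V$-monad $\widetilde{\mathbb T}$ on $\mathcal B$ with associated $\mathcal V$-reflective-subcategory $\mathcal B'$, the following are equivalent: (i) $\widetilde{\mathbb T}$ is an idempotent core of $\mathbb T$; (ii) $\widetilde{\mathbb T}$ is a terminal idempotent $\mathcal V$-monad over $\mathbb T$ and inverts the same morphisms as $T$; (iii) $\mathcal B'=\mathcal B_{\Sigma_T}$; (iv) $F\dashv G$ factors through $\mathcal B'\hookrightarrow\mathcal B$ in such a way that the induced left $\mathcal V$-adjoint $F'$ is conservative.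
   Context: No limits or colimits are assumed in $\mathcal V$. A morphism of a $\mathcal V$-category $\mathcal B$ means a morphism of its underlying ordinary category. Categories are not assumed locally small. A functor inverts a morphism if it sends it to an isomorphism. $\Sigma_T$ is the class of all morphisms of $\mathcal B$ inverted by $T$. For a class $\Sigma$ of morphisms, $\mathcal B_\Sigma$ is the full sub-$\mathcal V$-category of $\mathcal B$ on the objects $\Sigma^{\bot_{\mathcal V}}$, i.e. those objects $B$ such that $\mathcal B(h,B):\mathcal B(A_2,B)\to\mathcal B(A_1,B)$ is an isomorphism in $\mathcal V$ for every $h:A_1\to A_2$ in $\Sigma$. A $\mathcal V$-monad is idempotent if its multiplication is an isomorphism. A morphism of $\mathcal V$-monads on $\mathcal B$ is a $\mathcal V$-natural transformation of the underlying $\mathcal V$-endofunctors commuting with units and multiplications. A terminal idempotent $\mathcal V$-monad over $\mathbb T$ is an idempotent $\mathcal V$-monad $\widetilde{\mathbb T}$ on $\mathcal B$ for which there is a (necessarily unique) morphism of $\mathcal V$-monads $\iota:\widetilde{\mathbb T}\to\mathbb T$ such that for every morphism of $\mathcal V$-monads $\alpha:\mathbb S\to\mathbb T$ with $\mathbb S$ idempotent there is a unique morphism $\alpha_\sharp:\mathbb S\to\widetilde{\mathbb T}$ with $\iota\cdot\alpha_\sharp=\alpha$. An idempotent ($\mathcal V$-)core of $\mathbb T$ is an idempotent $\mathcal V$-monad on $\mathcal B$ whose underlying endofunctor inverts the same morphisms as $T$. A $\mathcal V$-reflective-subcategory of $\mathcal B$ is a full replete sub-$\mathcal V$-category $\mathcal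 B'$ whose inclusion $J$ has a left $\mathcal V$-adjoint $K$; any such $\mathcal V$-adjunction $K\dashv J$ is called a $\mathcal V$-reflection. The $\mathcal V$-reflective-subcategory associated to an idempotent $\mathcal V$-monad with unit $\rho$ consists of those $B$ with $\rho_B$ an isomorphism. A $\mathcal V$-adjunction $F\dashv G:\mathcal C\to\mathcal B$ factors through a $\mathcal V$-reflection $K\dashv J:\mathcal B'\hookrightarrow\mathcal B$ (equivalently, through $\mathcal B'$) if $GC\in\mathcal B'$ for all $C\in\mathcal C$. In this case the corestriction $G':\mathcal C\to\mathcal B'$ of $G$ has left $\mathcal V$-adjoint $F'=FJ$ (with $F'K\cong F$), called the induced left $\mathcal V$-adjoint. *)

(* Defs.v *)
From mathcomp Require Import ssreflect ssrfun.

Set Implicit Arguments.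
Unset Strict Implicit.
Unset Printing Implicit Defensive.

Declare Scope cat_scope.
Delimit Scope cat_scope with cat.
Local Open Scope cat_scope.

(* Objects and homs live in arbitrary universes: no local smallness. *)
Record Category := {
  ob :> Type;
  hom : ob -> ob -> Type;
  idc : forall A, hom A A;
  comp : forall A B C, hom B C -> hom A B -> hom A C;
  compA : forall A B C D (h : hom C D) (g : hom B C) (f : hom A B),
    comp h (comp g f) = comp (comp h g) f;
  comp1f : forall A B (f : hom A B), comp (idc B) f = f;
  compf1 : forall A B (f : hom A B), comp f (idc A) = f }.

Arguments hom {_} _ _.
Arguments idc {_ A}.
Arguments comp {_ A B C} _ _.
Notation "g ∘ f" := (comp g f) (at level 40, left associativity) : cat_scope.

Definition is_iso (X : Category) (A B : X) (f : hom A B) : Prop :=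
  exists g : hom B A, g ∘ f = idc /\ f ∘ g = idc.

Record iso (X : Category) (A B : X) := {
  iso_hom :> hom A B;
  iso_inv : hom B A;
  isoVK : iso_inv ∘ iso_hom = idc;
  isoKV : iso_hom ∘ iso_inv = idc }.

Record MonoidalCategory := {
  mcat :> Category;
  tens : mcat -> mcat -> mcat;
  tensm : forall (A A' B B' : mcat),
    hom A A' -> hom B B' -> hom (tens A B) (tens A' B');
  unit_ob : mcat;
  assoc : forall A B C : mcat, iso (tens (tens A B) C) (tens A (tens B C));
  lunit : forall A : mcat, iso (tens unit_ob A) A;
  runit : forall A : mcat, iso (tens A unit_ob) A;
  tensm1 : forall A B : mcat, tensm (@idc _ A) (@idc _ B) = idc;
  tensmM : forall (A A' A'' B B' B'' : mcat)
    (f' : hom A' A'') (f : hom A A') (g' : hom B' B'') (g : hom B B'),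
    tensm (f' ∘ f) (g' ∘ g) = tensm f' g' ∘ tensm f g;
  assoc_nat : forall (A A' B B' C C' : mcat)
    (f : hom A A') (g : hom B B') (h : hom C C'),
    assoc A' B' C' ∘ tensm (tensm f g) h = tensm f (tensm g h) ∘ assoc A B C;
  lunit_nat : forall (A A' : mcat) (f : hom A A'),
    lunit A' ∘ tensm idc f = f ∘ lunit A;
  runit_nat : forall (A A' : mcat) (f : hom A A'),
    runit A' ∘ tensm f idc = f ∘ runit A;
  pentagon : forall A B C D : mcat,
    assoc A B (tens C D) ∘ assoc (tens A B) C D
    = tensm idc (assoc B C D) ∘ assoc A (tens B C) D ∘ tensm (assoc A B C) idc;
  triangle : forall A B : mcat,
    tensm (@idc _ A) (lunit B) ∘ assoc A unit_ob B = tensm (runit A) idc }.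

Notation "A ⊗ B" := (tens A B) (at level 37, left associativity) : cat_scope.
Notation "f ⊠ g" := (tensm f g) (at level 37, left associativity) : cat_scope.
Arguments unit_ob {_}.
Notation 𝕀 := unit_ob.
Arguments assoc {_} _ _ _.
Arguments lunit {_} _.
Arguments runit {_} _.

Record SMCC := {
  smc_monoidal :> MonoidalCategory;
  braid : forall A B : smc_monoidal, hom (A ⊗ B) (B ⊗ A);
  braid_nat : forall (A A' B B' : smc_monoidal) (f : hom A A') (g : hom B B'),
    braid A' B' ∘ (f ⊠ g) = (g ⊠ f) ∘ braid A B;
  braidK : forall A B : smc_monoidal, braid B A ∘ braid A B = idc;
  hexagon : forall A B C : smc_monoidal,
    assoc B C A ∘ braid A (B ⊗ C) ∘ assoc A B C
    = (idc ⊠ braid A C) ∘ assoc B A C ∘ (braid A B ⊠ idc);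
  (* [- ⊗ B] has the right adjoint [ihom B], with counit [ev] *)
  ihom : smc_monoidal -> smc_monoidal -> smc_monoidal;
  ev : forall B C : smc_monoidal, hom (ihom B C ⊗ B) C;
  curry : forall A B C : smc_monoidal, hom (A ⊗ B) C -> hom A (ihom B C);
  curryK : forall (A B C : smc_monoidal) (f : hom (A ⊗ B) C),
    ev B C ∘ (curry f ⊠ idc) = f;
  curry_unique : forall (A B C : smc_monoidal) (f : hom (A ⊗ B) C)
    (g : hom A (ihom B C)), ev B C ∘ (g ⊠ idc) = f -> g = curry f }.

Section MonoidalTheory.
Variable V : MonoidalCategory.
Implicit Types A B C D : V.

Lemma iso_epi A B C (i : iso A B) (f g : hom B C) : f ∘ i = g ∘ i -> f = g.
Proof.
by move=> e; rewrite -[f]compf1 -[g]compf1 -(isoKV i) !compA e.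
Qed.

Lemma iso_mono A B C (i : iso A B) (f g : hom C A) : i ∘ f = i ∘ g -> f = g.
Proof.
by move=> e; rewrite -[f]comp1f -[g]comp1f -(isoVK i) -!compA e.
Qed.

Lemma tens_split A A' B B' (f : hom A A') (g : hom B B') :
  f ⊠ g = (f ⊠ idc) ∘ (idc ⊠ g).
Proof. by rewrite -tensmM compf1 comp1f. Qed.

Lemma tens_split' A A' B B' (f : hom A A') (g : hom B B') :
  f ⊠ g = (idc ⊠ g) ∘ (f ⊠ idc).
Proof. by rewrite -tensmM compf1 comp1f. Qed.

Lemma lunit_inv_nat A B (f : hom A B) :
  (idc ⊠ f) ∘ iso_inv (lunit A) = iso_inv (lunit B) ∘ f.
Proof.
by apply: (iso_mono (i := lunit B)); rewrite !compA lunit_nat isoKV -compA isoKV compf1 comp1f.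
Qed.

Lemma runit_inv_nat A B (f : hom A B) :
  (f ⊠ idc) ∘ iso_inv (runit A) = iso_inv (runit B) ∘ f.
Proof.
by apply: (iso_mono (i := runit B)); rewrite !compA runit_nat isoKV -compA isoKV compf1 comp1f.
Qed.

Lemma lunit_faithful A B (f g : hom A B) :
  @idc _ (@unit_ob V) ⊠ f = idc ⊠ g -> f = g.
Proof. by move=> e; apply: (iso_epi (i := lunit A)); rewrite -!lunit_nat e. Qed.

Lemma runit_faithful A B (f g : hom A B) :
  f ⊠ @idc _ (@unit_ob V) = g ⊠ idc -> f = g.
Proof. by move=> e; apply: (iso_epi (i := runit A)); rewrite -!runit_nat e. Qed.

Definition tensr_iso A B C (i : iso A B) : iso (A ⊗ C) (B ⊗ C).
Proof.
exists (i ⊠ idc) (iso_inv i ⊠ idc).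
- by rewrite -tensmM isoVK comp1f tensm1.
- by rewrite -tensmM isoKV comp1f tensm1.
Defined.

Lemma tens1M A B C D (g : hom B C) (f : hom A B) :
  @idc _ D ⊠ (g ∘ f) = (idc ⊠ g) ∘ (idc ⊠ f).
Proof. by rewrite -tensmM comp1f. Qed.

Lemma tensM1 A B C D (g : hom B C) (f : hom A B) :
  (g ∘ f) ⊠ @idc _ D = (g ⊠ idc) ∘ (f ⊠ idc).
Proof. by rewrite -tensmM comp1f. Qed.

Lemma lunit_tens A B : lunit (A ⊗ B) ∘ assoc 𝕀 A B = lunit A ⊠ idc.
Proof.
apply: lunit_faithful.
apply: (iso_epi (i := assoc 𝕀 (𝕀 ⊗ A) B)).
apply: (iso_epi (i := tensr_iso B (assoc 𝕀 𝕀 A))) => /=.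
rewrite tens1M -!compA (compA _ _ (_ ⊠ _)) -pentagon compA triangle.
by rewrite -[@idc _ (A ⊗ B)]tensm1 -assoc_nat -triangle tensM1 !compA assoc_nat.
Qed.

Lemma lunit_tens_inv A B :
  assoc 𝕀 A B ∘ (iso_inv (lunit A) ⊠ idc) = iso_inv (lunit (A ⊗ B)).
Proof.
apply: (iso_mono (i := lunit (A ⊗ B))).
by rewrite compA lunit_tens -tensmM !isoKV comp1f tensm1.
Qed.

Lemma lunit_lunit A : lunit (𝕀 ⊗ A) = idc ⊠ lunit A :> hom _ _.
Proof. by apply: (iso_mono (i := lunit A)); rewrite lunit_nat. Qed.

Lemma lunit_runit : lunit 𝕀 = runit 𝕀 :> hom (𝕀 ⊗ 𝕀) (@unit_ob V).
Proof. by apply: runit_faithful; rewrite -lunit_tens lunit_lunit triangle. Qed.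

Lemma lrunit_inv : iso_inv (lunit 𝕀) = iso_inv (runit (@unit_ob V)).
Proof. by apply: (iso_mono (i := lunit 𝕀)); rewrite isoKV lunit_runit isoKV. Qed.

Lemma assoc_runit_inv A B :
  assoc A 𝕀 B ∘ (iso_inv (runit A) ⊠ idc) = idc ⊠ iso_inv (lunit B).
Proof.
have e : (idc ⊠ iso_inv (lunit B)) ∘ (@idc _ A ⊠ lunit B) = idc.
  by rewrite -tensmM isoVK comp1f tensm1.
rewrite -[LHS]comp1f -e -!compA [(idc ⊠ lunit B) ∘ _]compA triangle.
by rewrite -tensmM isoKV comp1f tensm1 compf1.
Qed.

End MonoidalTheory.

Record VCategory (V : MonoidalCategory) := {
  vob :> Type;
  vhom : vob -> vob -> V;
  vid : forall A, hom 𝕀 (vhom A A);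
  vcomp : forall A B C, hom (vhom B C ⊗ vhom A B) (vhom A C);
  vcompA : forall A B C D,
    @vcomp A B D ∘ (@vcomp B C D ⊠ idc)
    = @vcomp A C D ∘ (idc ⊠ @vcomp A B C) ∘ assoc _ _ _;
  vcomp1l : forall A B, @vcomp A B B ∘ (vid B ⊠ idc) = lunit (vhom A B);
  vcomp1r : forall A B, @vcomp A A B ∘ (idc ⊠ vid A) = runit (vhom A B) }.

Arguments vhom {V} _ _ _.
Arguments vid {V} _ _.
Arguments vcomp {V} _ _ _ _.

Section Underlying.
Variables (V : MonoidalCategory) (B : VCategory V).
Implicit Types X Y Z : B.

Definition ucomp X Y Z (g : hom 𝕀 (vhom B Y Z)) (f : hom 𝕀 (vhom B X Y)) :
  hom 𝕀 (vhom B X Z) := vcomp B X Y Z ∘ (g ⊠ f) ∘ iso_inv (lunit 𝕀).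

(* [B(W, g)] *)
Definition postcomp W X Y (g : hom 𝕀 (vhom B X Y)) :
  hom (vhom B W X) (vhom B W Y) :=
  vcomp B W X Y ∘ (g ⊠ idc) ∘ iso_inv (lunit (vhom B W X)).

(* [B(h, W)] *)
Definition precomp W X Y (h : hom 𝕀 (vhom B X Y)) :
  hom (vhom B Y W) (vhom B X W) :=
  vcomp B X Y W ∘ (idc ⊠ h) ∘ iso_inv (runit (vhom B Y W)).

Lemma postcompf (A : V) W X Y (g : hom 𝕀 (vhom B X Y)) (p : hom A (vhom B W X)) :
  postcomp W g ∘ p = vcomp B W X Y ∘ (g ⊠ p) ∘ iso_inv (lunit A).
Proof. by rewrite /postcomp -compA -lunit_inv_nat compA -(compA _ (g ⊠ _)) -tens_split. Qed.

Lemma precompf (A : V) W X Y (h : hom 𝕀 (vhom B X Y)) (p : hom A (vhom B Y W)) :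
  precomp W h ∘ p = vcomp B X Y W ∘ (p ⊠ h) ∘ iso_inv (runit A).
Proof. by rewrite /precomp -compA -runit_inv_nat compA -(compA _ (_ ⊠ h)) -tens_split'. Qed.

Lemma postcompE X Y Z (g : hom 𝕀 (vhom B Y Z)) (f : hom 𝕀 (vhom B X Y)) :
  postcomp X g ∘ f = ucomp g f.
Proof. exact: postcompf. Qed.

Lemma precompE X Y Z (g : hom 𝕀 (vhom B Y Z)) (f : hom 𝕀 (vhom B X Y)) :
  precomp Z f ∘ g = ucomp g f.
Proof. by rewrite precompf -lrunit_inv. Qed.

Lemma postcompM W X Y Z (g : hom 𝕀 (vhom B Y Z)) (f : hom 𝕀 (vhom B X Y)) :
  postcomp W (ucomp g f) = postcomp W g ∘ postcomp W f.
Proof.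
rewrite postcompf /postcomp /ucomp !tensM1 !compA vcompA -(compA _ (assoc _ _ _)).
rewrite assoc_nat !compA -(compA _ (assoc _ _ _)) lrunit_inv assoc_runit_inv.
congr (_ ∘ _); rewrite -!compA; congr (_ ∘ _).
by rewrite -!tensmM !comp1f !compf1 compA.
Qed.

Lemma precompM W X Y Z (g : hom 𝕀 (vhom B Y Z)) (f : hom 𝕀 (vhom B X Y)) :
  precomp W (ucomp g f) = precomp W f ∘ precomp W g.
Proof.
rewrite precompf /precomp /ucomp; congr (_ ∘ _).
rewrite !tens1M -assoc_runit_inv !compA.
rewrite -(compA _ _ (assoc _ _ _)) -assoc_nat compA -vcompA.
rewrite -!compA; congr (_ ∘ _).
by rewrite -!tensmM !comp1f !compf1 compA.
Qed.

Lemma post_pre W X Y Z (g : hom 𝕀 (vhom B Y Z)) (f : hom 𝕀 (vhom B W X)) :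
  postcomp W g ∘ precomp Y f = precomp Z f ∘ postcomp X g.
Proof.
rewrite postcompf precompf.
have -> : g ⊠ precomp Y f =
    (idc ⊠ vcomp B W X Y) ∘ (g ⊠ (idc ⊠ f)) ∘ (idc ⊠ iso_inv (runit _)).
  by rewrite -!tensmM !comp1f !compf1.
have -> : postcomp X g ⊠ f =
    (vcomp B X Y Z ⊠ idc) ∘ ((g ⊠ idc) ⊠ f) ∘ (iso_inv (lunit _) ⊠ idc).
  by rewrite -!tensmM !comp1f !compf1.
rewrite !compA vcompA -(compA _ (assoc _ _ _)) assoc_nat.
rewrite -!compA; do 3!congr (_ ∘ _).
by rewrite compA lunit_tens_inv lunit_inv_nat.
Qed.

Lemma ucompA W X Y Z (h : hom 𝕀 (vhom B Y Z)) (g : hom 𝕀 (vhom B X Y))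
    (f : hom 𝕀 (vhom B W X)) :
  ucomp h (ucomp g f) = ucomp (ucomp h g) f.
Proof. by rewrite -[RHS]postcompE postcompM -compA !postcompE. Qed.

Lemma postcomp1 W X : postcomp W (vid B X) = idc.
Proof. by rewrite /postcomp vcomp1l isoKV. Qed.

Lemma precomp1 W X : precomp W (vid B X) = idc.
Proof. by rewrite /precomp vcomp1r isoKV. Qed.

Lemma ucomp1f X Y (f : hom 𝕀 (vhom B X Y)) : ucomp (vid B Y) f = f.
Proof. by rewrite -postcompE postcomp1 comp1f. Qed.

Lemma ucompf1 X Y (f : hom 𝕀 (vhom B X Y)) : ucomp f (vid B X) = f.
Proof. by rewrite -precompE precomp1 comp1f. Qed.

Definition underlying : Category := {|
  ob := vob B;
  hom := fun X Y => hom 𝕀 (vhom B X Y);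
  idc := vid B;
  comp := ucomp;
  compA := ucompA;
  comp1f := ucomp1f;
  compf1 := ucompf1 |}.

End Underlying.

(* A morphism of [B] is a morphism of its underlying ordinary category; below
   [g ∘ f] and [is_iso] are used for these through [underlying B]. *)
Notation mor B := (@hom (underlying B)).

Record VFunctor (V : MonoidalCategory) (B C : VCategory V) := {
  fob :> B -> C;
  fmap : forall X Y, hom (vhom B X Y) (vhom C (fob X) (fob Y));
  fmap1 : forall X, fmap X X ∘ vid B X = vid C (fob X);
  fmapM : forall X Y Z, fmap X Z ∘ vcomp B X Y Z
    = vcomp C (fob X) (fob Y) (fob Z) ∘ (fmap Y Z ⊠ fmap X Y) }.

Arguments fmap {V B C} _ _ _.

Section Functors.
Variable V : MonoidalCategory.
Implicit Types B C D : VCategory V.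

Program Definition vfun_id B : VFunctor B B :=
  {| fob := fun X => X; fmap := fun X Y => idc |}.
Next Obligation. by move=> * /=; rewrite comp1f. Qed.
Next Obligation. by move=> * /=; rewrite comp1f tensm1 compf1. Qed.

Program Definition vfun_comp B C D (G : VFunctor C D) (F : VFunctor B C) :
  VFunctor B D :=
  {| fob := fun X => G (F X); fmap := fun X Y => fmap G _ _ ∘ fmap F X Y |}.
Next Obligation. by move=> * /=; rewrite -compA !fmap1. Qed.
Next Obligation. by move=> * /=; rewrite -compA fmapM compA fmapM tensmM compA. Qed.

Definition umap B C (F : VFunctor B C) (X Y : B) (f : mor B X Y) :
  mor C (F X) (F Y) := (fmap F X Y : hom (vhom B X Y) _) ∘ f.

Lemma fmap_postcomp B C (F : VFunctor B C) (W X Y : B) (g : mor B X Y) :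
  fmap F W Y ∘ postcomp W g = postcomp (F W) (umap F g) ∘ fmap F W X.
Proof. by rewrite postcompf /postcomp !compA fmapM -(compA (vcomp _ _ _ _)) -tensmM compf1. Qed.

Lemma fmap_precomp B C (F : VFunctor B C) (W X Y : B) (g : mor B X Y) :
  fmap F X W ∘ precomp W g = precomp (F W) (umap F g) ∘ fmap F Y W.
Proof. by rewrite precompf /precomp !compA fmapM -(compA (vcomp _ _ _ _)) -tensmM compf1. Qed.

Lemma umapM B C (F : VFunctor B C) (X Y Z : B) (g : mor B Y Z) (f : mor B X Y) :
  umap F (g ∘ f) = umap F g ∘ umap F f.
Proof.
by rewrite /umap /= -postcompE compA fmap_postcomp -compA postcompE.
Qed.

Lemma umap1 B C (F : VFunctor B C) (X : B) :
  umap F (idc : mor B X X) = idc.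
Proof. exact: fmap1. Qed.

Lemma umap_comp B C D (G : VFunctor C D) (F : VFunctor B C) (X Y : B)
  (f : mor B X Y) : umap (vfun_comp G F) f = umap G (umap F f).
Proof. by rewrite /umap /= compA. Qed.

Definition inverts B C (F : VFunctor B C) (X Y : B) (f : mor B X Y) : Prop :=
  is_iso (umap F f).

Definition conservative B C (F : VFunctor B C) : Prop :=
  forall (X Y : B) (f : mor B X Y), is_iso (umap F f) -> is_iso f.

(* [vnat_natural] is the usual [V]-naturality hexagon, written as
   [C(1, α_Y) ∘ F = C(α_X, 1) ∘ G] *)
Record VNat B C (F G : VFunctor B C) := {
  vnat :> forall X, mor C (F X) (G X);
  vnat_natural : forall X Y,
    postcomp (F X) (vnat Y) ∘ fmap F X Y = precomp (G Y) (vnat X) ∘ fmap G X Y }.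

Lemma vnat_umap B C (F G : VFunctor B C) (a : VNat F G) (X Y : B) (f : mor B X Y) :
  a Y ∘ umap F f = umap G f ∘ a X.
Proof.
by rewrite /= -postcompE -precompE /umap !compA vnat_natural.
Qed.

Program Definition vnat_id B C (F : VFunctor B C) : VNat F F :=
  {| vnat := fun X => idc |}.
Next Obligation. by move=> * /=; rewrite postcomp1 precomp1. Qed.

Program Definition vnat_comp B C (F G H : VFunctor B C)
    (b : VNat G H) (a : VNat F G) : VNat F H :=
  {| vnat := fun X => b X ∘ a X |}.
Next Obligation.
move=> B C F G H b a X Y /=.
by rewrite postcompM precompM -compA vnat_natural compA post_pre -compA vnat_natural compA.
Qed.

Definition vnat_is_iso B C (F G : VFunctor B C) (a : VNat F G) : Prop :=
  exists b : VNat G F,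
    vnat_comp b a = vnat_id F /\ vnat_comp a b = vnat_id G.

Record VMonad B := {
  mfun :> VFunctor B B;
  munit : VNat (vfun_id B) mfun;
  mmult : VNat (vfun_comp mfun mfun) mfun;
  mmultA : forall X : B, mmult X ∘ umap mfun (mmult X) = mmult X ∘ mmult (mfun X);
  mmult1l : forall X : B, mmult X ∘ munit (mfun X) = idc;
  mmult1r : forall X : B, mmult X ∘ umap mfun (munit X) = idc }.

Definition idempotent B (T : VMonad B) : Prop := vnat_is_iso (mmult T).

Definition is_monad_morphism B (S T : VMonad B) (a : VNat S T) : Prop :=
  (forall X : B, a X ∘ munit S X = munit T X) /\
  (forall X : B, a X ∘ mmult S X = mmult T X ∘ (umap T (a X) ∘ a (S X))).

Definition inverts_same B (S T : VMonad B) : Prop :=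
  forall (X Y : B) (f : mor B X Y), inverts S f <-> inverts T f.

(* [S] is an idempotent core of [T] *)
Definition idempotent_core B (T S : VMonad B) : Prop :=
  idempotent S /\ inverts_same S T.

(* [S] is a terminal idempotent monad over [T] *)
Definition terminal_idempotent B (T S : VMonad B) : Prop :=
  idempotent S /\
  exists i : VNat S T, is_monad_morphism i /\
    forall (R : VMonad B) (a : VNat R T),
      idempotent R -> is_monad_morphism a ->
      exists! b : VNat R S, is_monad_morphism b /\ vnat_comp i b = a.

Record VAdjunction B C (F : VFunctor B C) (G : VFunctor C B) := {
  aunit : VNat (vfun_id B) (vfun_comp G F);
  acounit : VNat (vfun_comp F G) (vfun_id C);
  atriangleF : forall X : B, acounit (F X) ∘ umap F (aunit X) = idc;
  atriangleG : forall Y : C, umap G (acounit Y) ∘ aunit (G Y) = idc }.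

Section InducedMonad.
Variables (B C : VCategory V) (F : VFunctor B C) (G : VFunctor C B).
Variable FG : VAdjunction F G.

Program Definition induced_mult :
    VNat (vfun_comp (vfun_comp G F) (vfun_comp G F)) (vfun_comp G F) :=
  {| vnat := fun X => umap G (acounit FG (F X)) |}.
Next Obligation.
move=> X Y /=.
have := vnat_natural (acounit FG) (F X) (F Y); rewrite /= compf1 => e.
rewrite !compA -fmap_precomp -e -fmap_postcomp.
by rewrite !compA.
Qed.

Program Definition induced_monad : VMonad B :=
  {| mfun := vfun_comp G F; munit := aunit FG; mmult := induced_mult |}.
Next Obligation.
move=> X; pose e Y := acounit FG Y : mor C (F (G Y)) Y.
change (umap G (e (F X)) ∘ umap (vfun_comp G F) (umap G (e (F X)))
  = umap G (e (F X)) ∘ umap G (e (F (G (F X))))).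
have n : e (F X) ∘ umap F (umap G (e (F X))) = e (F X) ∘ e (F (G (F X))).
  have := vnat_umap (acounit FG) (e (F X)).
  by rewrite umap_comp [umap (vfun_id C) _]comp1f.
rewrite umap_comp -[RHS]umapM.
exact: etrans (esym (umapM G _ _)) (congr1 (@umap _ _ G _ _) n).
Qed.
Next Obligation. by move=> X; exact: (atriangleG FG (F X)). Qed.
Next Obligation.
move=> X; pose e Y := acounit FG Y : mor C (F (G Y)) Y.
pose u Y := aunit FG Y : mor B Y (G (F Y)).
change (umap G (e (F X)) ∘ umap (vfun_comp G F) (u X) = idc).
have t : e (F X) ∘ umap F (u X) = idc := atriangleF FG X.
rewrite umap_comp; apply: etrans (esym (umapM G _ _)) _.
exact: etrans (congr1 (@umap _ _ G _ _) t) (umap1 G (F X)).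
Qed.

End InducedMonad.

(* Full sub-[V]-categories of [B] are given by predicates on objects. *)
Program Definition full B (P : B -> Prop) : VCategory V :=
  {| vob := sig P;
     vhom := fun X Y => vhom B (proj1_sig X) (proj1_sig Y);
     vid := fun X => vid B (proj1_sig X);
     vcomp := fun X Y Z => vcomp B (proj1_sig X) (proj1_sig Y) (proj1_sig Z) |}.
Next Obligation. by move=> *; exact: vcompA. Qed.
Next Obligation. by move=> *; exact: vcomp1l. Qed.
Next Obligation. by move=> *; exact: vcomp1r. Qed.

Program Definition incl B (P : B -> Prop) : VFunctor (full P) B :=
  {| fob := fun X => proj1_sig X; fmap := fun X Y => idc |}.
Next Obligation. by move=> * /=; rewrite comp1f. Qed.
Next Obligation. by move=> * /=; rewrite comp1f tensm1 compf1. Qed.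

Definition replete B (P : B -> Prop) : Prop :=
  forall (X Y : B) (f : mor B X Y), is_iso f -> P X -> P Y.

Definition reflective B (P : B -> Prop) : Prop :=
  replete P /\ exists K : VFunctor B (full P), inhabited (VAdjunction K (incl P)).

(* the class of objects [V]-orthogonal to [Sigma]: the objects of [B_Sigma] *)
Definition orthogonal B (Sigma : forall X Y : B, mor B X Y -> Prop) (W : B) :
  Prop :=
  forall (X Y : B) (h : mor B X Y), Sigma X Y h -> is_iso (precomp W h).

Definition associated_subcategory B (T : VMonad B) (X : B) : Prop :=
  is_iso (munit T X).

Section Factorization.
Variables (B C : VCategory V) (F : VFunctor B C) (G : VFunctor C B).
Variable FG : VAdjunction F G.

Definition factors_through (P : B -> Prop) : Prop := forall Y : C, P (G Y).

Variables (P : B -> Prop) (PG : factors_through P).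

Program Definition corestriction : VFunctor C (full P) :=
  {| fob := fun Y => exist P (G Y) (PG Y); fmap := fun X Y => fmap G X Y |}.
Next Obligation. by move=> *; exact: fmap1. Qed.
Next Obligation. by move=> *; exact: fmapM. Qed.

(* the induced left adjoint [F' = F J]; see [induced_adjunction] *)
Definition induced_left : VFunctor (full P) C := vfun_comp F (incl P).

Program Definition induced_adjunction : VAdjunction induced_left corestriction :=
  {| aunit := {| vnat := fun X => aunit FG (proj1_sig X) |};
     acounit := {| vnat := fun Y => acounit FG Y |} |}.
Next Obligation.
move=> X Y /=; have := vnat_natural (aunit FG) (proj1_sig X) (proj1_sig Y).
by rewrite /= !compf1.
Qed.
Next Obligation.
move=> X Y /=; have := vnat_natural (acounit FG) X Y.
by rewrite /= !compf1.
Qed.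
Next Obligation.
move=> X; have := atriangleF FG (proj1_sig X).
by rewrite /umap /= compf1.
Qed.
Next Obligation. by move=> Y; exact: (atriangleG FG Y). Qed.
End Factorization.

End Functors.

(* Main.v *)
From mathcomp Require Import ssreflect ssrfun.
From Stdlib Require Import FunctionalExtensionality ProofIrrelevance.
From Stdlib Require Import IndefiniteDescription.
Require Import Defs.

(** Everything rests on one observation about an arbitrary V-monad [T]: if the
    unit [W -> T W] has a retraction, then [W] is orthogonal, in the enriched
    sense, to every morphism inverted by [T] ([split_unit_orthogonal]).  It
    applies to the free objects [T Z], to the values of the right adjoint of any
    adjunction inducing [T], and to the objects of the reflective subcategory of
    an idempotent monad.  For free objects there is a converse: a morphism
    orthogonal to all [T Z] is inverted by [T] ([inverts_of_orthogonal]).  Hence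
    [Sigma_T] is included in [Sigma_S] as soon as every [S Z] is orthogonal to
    [Sigma_T] ([inverts_incl]).

    Let [S] be idempotent.  Its unit lies in [Sigma_S], and its subcategory [B']
    is the class of objects orthogonal to [Sigma_S]
    ([associated_orthogonal]).  This gives (i) <-> (iii): if [Sigma_S] and
    [Sigma_T] agree, so do the classes of objects orthogonal to them; and
    if [B'] is the class orthogonal to [Sigma_T], then each of [S], [T] has its
    free objects orthogonal to the morphisms inverted by the other one.

    For (i) <-> (ii), a monad morphism from [S] to any monad [T] exists if and
    only if [Sigma_S] is included in [Sigma_T], and it is then unique
    ([monad_morphism_exists], [inverts_of_monad_morphism],
    [monad_morphism_unique]): the units of [S] belong to [Sigma_T], and
    [T X] is orthogonal to them, so transformations out of [S] are determined,
    and equations between them may be verified, after precomposition with a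
    unit.  Terminality of a core among idempotent monads over [T] becomes the
    transitivity of inclusion between classes of inverted morphisms.

    For (i) <-> (iv), [F] and [T = G F] invert the same morphisms
    ([induced_monad_inverts]).  On [B'] the unit of [S] is invertible, hence a
    morphism of [B'] inverted by [S] is already invertible, and conservativity
    of [F'] follows from [Sigma_T] being included in [Sigma_S].  Conversely,
    if [G] takes its values in [B'], every [T X] is orthogonal to [Sigma_S], so
    [Sigma_S] is included in [Sigma_T].  In particular the unit of [S] is
    inverted by [F], so [F] inverts [S f] whenever it inverts [f], and
    conservativity of [F'] makes [S f] invertible.

    Finally, idempotent monads and reflective subcategories correspond
    ([idempotent_of_reflective], [reflective_of_idempotent]), which turns the
    equivalences for a given [S] into the equivalences between existence
    statements. *)

Set Implicit Arguments.
Unset Strict Implicit.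
Unset Printing Implicit Defensive.

Local Open Scope cat_scope.


(** * Isomorphisms in a category *)

Section Isomorphisms.
Variable X : Category.

Lemma is_iso_comp (A B C : X) (g : hom B C) (f : hom A B) :
  is_iso g -> is_iso f -> is_iso (g ∘ f).
Proof.
move=> [g' [gK Kg]] [f' [fK Kf]]; exists (f' ∘ g'); split.
- by rewrite -compA (compA g') gK comp1f.
- by rewrite -compA (compA f) Kf comp1f.
Qed.

Lemma is_iso_of_comp_r (A B C : X) (g : hom B C) (f : hom A B) :
  is_iso g -> is_iso (g ∘ f) -> is_iso f.
Proof.
move=> [g' [gK Kg]] gf.
have -> : f = g' ∘ (g ∘ f) by rewrite compA gK comp1f.
by apply: is_iso_comp gf; exists g.
Qed.

Lemma is_iso_of_comp_l (A B C : X) (g : hom B C) (f : hom A B) :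
  is_iso f -> is_iso (g ∘ f) -> is_iso g.
Proof.
move=> [f' [fK Kf]] gf.
have -> : g = (g ∘ f) ∘ f' by rewrite -compA Kf compf1.
by apply: is_iso_comp gf _; exists f.
Qed.

Lemma iso_inverse_eq (A B : X) (f : hom A B) (g : hom B A) :
  is_iso f -> f ∘ g = idc -> g ∘ f = idc.
Proof.
move=> [f' [fK Kf]] e; suff -> : g = f' by [].
by rewrite -[g]comp1f -fK -compA e compf1.
Qed.

End Isomorphisms.

(** * Orthogonality and unique extension *)

Section Orthogonality.
Variables (V : MonoidalCategory) (B : VCategory V).

(** The next four lemmas express the functoriality of the hom objects through
    composition in [underlying B], the form in which all later equations
    between morphisms of [B] are written. *)
Lemma postcomp_comp (W X Y Z : B) (g : mor B Y Z) (f : mor B X Y) :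
  postcomp W (g ∘ f) = postcomp W g ∘ postcomp W f.
Proof. exact: postcompM. Qed.

Lemma precomp_comp (W X Y Z : B) (g : mor B Y Z) (f : mor B X Y) :
  precomp W (g ∘ f) = precomp W f ∘ precomp W g.
Proof. exact: precompM. Qed.

Lemma postcomp_idc (W X : B) : postcomp W (idc : mor B X X) = idc.
Proof. exact: postcomp1. Qed.

Lemma precomp_idc (W X : B) : precomp W (idc : mor B X X) = idc.
Proof. exact: precomp1. Qed.

(** An inverse of [precomp W h] acts on the points of the hom objects, so
    enriched orthogonality implies the ordinary one; this lemma and the next are
    its existence and uniqueness halves. *)
Lemma orthogonal_extend (W X Y : B) (h : mor B X Y) (g : mor B X W) :
  is_iso (precomp W h) -> exists g' : mor B Y W, g' ∘ h = g.
Proof.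
move=> [p [_ Kp]]; exists (p ∘ g).
by rewrite /= -precompE compA Kp comp1f.
Qed.

Lemma orthogonal_unique (W X Y : B) (h : mor B X Y) (g g' : mor B Y W) :
  is_iso (precomp W h) -> g ∘ h = g' ∘ h -> g = g'.
Proof.
move=> [p [pK _]]; rewrite /= -!precompE => e.
by rewrite -[g](@comp1f V) -[g'](@comp1f V) -pK -!(compA p) e.
Qed.

End Orthogonality.

(** * Enriched natural transformations *)

Section NaturalTransformations.
Variable V : MonoidalCategory.
Implicit Types B C : VCategory V.

(** Naturality is a proposition, so only the components of a transformation
    count for equality. *)
Lemma vnat_eq B C (F G : VFunctor B C) (a b : VNat F G) :
  (forall X, a X = b X) -> a = b.
Proof.
case: a b => [a aN] [b bN] /= e.
have eqab : a = b by apply: functional_extensionality_dep.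
by case: _ / eqab bN => bN; congr Build_VNat; apply: proof_irrelevance.
Qed.

Lemma umap_is_iso B C (F : VFunctor B C) (X Y : B) (f : mor B X Y) :
  is_iso f -> is_iso (umap F f).
Proof.
move=> [g [gK Kg]]; exists (umap F g).
by rewrite -!umapM gK Kg !umap1.
Qed.

(** The inverse components are picked by choice, because [is_iso] only asserts
    their existence; the naturality square of the inverse is that of [a],
    composed on both sides with them. *)
Lemma vnat_inverse B C (F G : VFunctor B C) (a : VNat F G) :
  (forall X, is_iso (a X)) -> vnat_is_iso a.
Proof.
move=> /(fun h X => constructive_indefinite_description _ (h X)) inv.
pose b X := proj1_sig (inv X).
have bK X : b X ∘ a X = idc by case: (proj2_sig (inv X)).
have Kb X : a X ∘ b X = idc by case: (proj2_sig (inv X)).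
have nat X Y : postcomp (G X) (b Y) ∘ fmap G X Y
    = precomp (F Y) (b X) ∘ fmap F X Y.
  rewrite -[fmap G X Y]comp1f -(precomp_idc (G Y) (G X)) -Kb.
  rewrite precomp_comp -(compA _ (precomp _ (a X))) -vnat_natural.
  rewrite (compA (postcomp _ (b Y))) post_pre -(compA (precomp _ (b X))).
  by rewrite (compA (postcomp _ (b Y))) -postcomp_comp (bK Y) postcomp_idc comp1f.
exists (Build_VNat nat); split; apply: vnat_eq => X /=; [exact: bK | exact: Kb].
Qed.

Definition unit_whisker B C (S : VMonad C) (T : VFunctor B C) :
  VNat T (vfun_comp S T).
Proof.
exists (fun X => munit S (T X)) => X Y /=.
have := vnat_natural (munit S) (T X) (T Y); rewrite /= compf1 => ->.
by rewrite (compA (precomp _ _)).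
Defined.

(** This transformation and [unit_whisker] have the same codomain; once the
    latter is invertible, the former followed by its inverse is a
    transformation from [S] to [T]. *)
Definition whisker_unit B C (S : VFunctor B C) (T : VMonad B) :
  VNat S (vfun_comp S T).
Proof.
exists (fun X => umap S (munit T X)) => X Y /=.
have := vnat_natural (munit T) X Y; rewrite /= compf1 -fmap_postcomp => ->.
by rewrite (compA (fmap S _ _)) fmap_precomp -(compA (precomp _ _)).
Defined.

End NaturalTransformations.

(** * Morphisms inverted by a monad *)

Section Monads.
Variables (V : MonoidalCategory) (B : VCategory V).
Implicit Types R S T : VMonad B.

Lemma unit_natural T (X Y : B) (f : mor B X Y) :
  munit T Y ∘ f = umap T f ∘ munit T X.
Proof. by rewrite -vnat_umap [umap (vfun_id B) f]comp1f. Qed.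

(** With [h : X -> Y], an element [p] of [B(X, W)] extends along [h] as
    [a ∘ T p ∘ (T h)^-1 ∘ η_Y]: naturality of [η] and [a ∘ η_W = 1] make this
    assignment inverse to precomposition with [h]. *)
Lemma split_unit_orthogonal T (W : B) (a : mor B (T W) W) :
  a ∘ munit T W = idc -> orthogonal (@inverts V B B T) W.
Proof.
move=> aK X Y h [t [tK Kt]].
(* [phi] is transposition: restricted along the unit it is the identity *)
pose phi Z : hom (vhom B Z W) (vhom B (T Z) W) := postcomp (T Z) a ∘ fmap T Z W.
have phiK Z : precomp W (munit T Z) ∘ phi Z = idc.
  rewrite /phi (compA (precomp _ _)) -post_pre -(compA (postcomp _ _)).
  have := vnat_natural (munit T) Z W; rewrite /= compf1 => <-.
  by rewrite -postcomp_comp aK postcomp_idc.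
have phi_h : phi X ∘ precomp W h = precomp W (umap T h) ∘ phi Y.
  rewrite /phi -(compA (postcomp _ _)) fmap_precomp (compA (postcomp _ _)).
  by rewrite post_pre -(compA (precomp _ _)).
exists (precomp W (munit T Y) ∘ precomp W t ∘ phi X); split.
- rewrite -(compA _ (phi X)) phi_h (compA _ (precomp W (umap T h))).
  by rewrite -(compA _ (precomp W t)) -precomp_comp Kt precomp_idc compf1 phiK.
- rewrite 2!(compA (precomp W h)) -!precomp_comp unit_natural.
  by rewrite (compA t) tK comp1f phiK.
Qed.

Lemma free_orthogonal T (Z X Y : B) (h : mor B X Y) :
  inverts T h -> is_iso (precomp (T Z) h).
Proof. exact: (split_unit_orthogonal (mmult1l T Z)). Qed.

(** Extending [η_X] along [h] to [g : Y -> T X], the transpose [μ_X ∘ T g] is an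
    inverse of [T h].  One composite is governed by [g ∘ h = η_X], the other by
    [T h ∘ g = η_Y], which uniqueness of extensions provides. *)
Lemma inverts_of_orthogonal T (X Y : B) (h : mor B X Y) :
  (forall Z, is_iso (precomp (T Z) h)) -> inverts T h.
Proof.
move=> orth; have [g gh] := orthogonal_extend (munit T X) (orth X).
have hg : umap T h ∘ g = munit T Y.
  apply: (orthogonal_unique (orth Y)).
  by rewrite -compA gh unit_natural.
exists (mmult T X ∘ umap T g); split.
- by rewrite -compA -umapM gh mmult1r.
- by rewrite compA -vnat_umap umap_comp -compA -umapM hg mmult1r.
Qed.

Lemma inverts_incl T S :
  (forall X, orthogonal (@inverts V B B T) (S X)) ->
  forall (X Y : B) (h : mor B X Y), inverts T h -> inverts S h.
Proof. by move=> orth X Y h Th; apply: inverts_of_orthogonal => Z; exact: orth. Qed.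

(** Since [η_S] is a section of [μ] and is V-natural, idempotency reduces to the
    other composite being the identity, componentwise. *)
Lemma idempotent_unitP S :
  idempotent S <-> forall X, munit S (S X) ∘ mmult S X = idc.
Proof.
split=> [[b [bK Kb]] X | e].
- apply: iso_inverse_eq (mmult1l S X).
  exists (b X); split.
  + by have := congr1 (fun a : VNat _ _ => a X) bK.
  + by have := congr1 (fun a : VNat _ _ => a X) Kb.
- exists (unit_whisker S S); split; apply: vnat_eq => X /=; first exact: e.
  exact: (mmult1l S X).
Qed.

(** * Idempotent monads *)

Section Idempotent.
Variable S : VMonad B.
Hypothesis idS : idempotent S.

Lemma unit_free_iso (X : B) : is_iso (munit S (S X)).
Proof.
exists (mmult S X); split; first exact: mmult1l.
by move: X; apply/idempotent_unitP.
Qed.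

Lemma umap_unit (X : B) : umap S (munit S X) = munit S (S X).
Proof.
rewrite -[LHS]comp1f -(proj1 (idempotent_unitP S) idS) -compA mmult1r.
exact: compf1.
Qed.

Lemma inverts_unit (X : B) : inverts S (munit S X).
Proof. by rewrite /inverts umap_unit; exact: unit_free_iso. Qed.

(** An object orthogonal to [Sigma_S] is orthogonal to its own unit, so the
    identity extends to a retraction of it; the retraction is a two-sided
    inverse because [S X] is orthogonal to the unit as well. *)
Lemma associated_orthogonal (X : B) :
  associated_subcategory S X <-> orthogonal (@inverts V B B S) X.
Proof.
split=> [[r [rK _]] | orth]; first exact: split_unit_orthogonal rK.
have [r rK] := orthogonal_extend idc (orth _ _ _ (inverts_unit X)).
exists r; split=> //.
apply: (orthogonal_unique (free_orthogonal _ (inverts_unit X))).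
by rewrite -compA rK comp1f compf1.
Qed.

Lemma monad_morphism_unique T (a b : VNat S T) :
  (forall (X Y : B) (h : mor B X Y), inverts S h -> inverts T h) ->
  (forall X : B, a X ∘ munit S X = munit T X) ->
  (forall X : B, b X ∘ munit S X = munit T X) -> a = b.
Proof.
move=> ST aU bU; apply: vnat_eq => X.
apply: (orthogonal_unique (free_orthogonal _ (ST _ _ _ (inverts_unit X)))).
by rewrite aU bU.
Qed.

(** The morphism is [(η^S_T)^-1 ∘ S η^T].  The inverse exists because [T X] is
    orthogonal to [Sigma_T], hence to the smaller [Sigma_S]. *)
Lemma monad_morphism_exists T :
  (forall (X Y : B) (h : mor B X Y), inverts S h -> inverts T h) ->
  exists a : VNat S T, is_monad_morphism a.
Proof.
move=> ST.
have TX X : is_iso (unit_whisker S T X).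
  apply/associated_orthogonal => Y Z h /ST; exact: free_orthogonal.
have [r [rK Kr]] := vnat_inverse TX.
pose a := vnat_comp r (whisker_unit S T).
have aU X : a X ∘ munit S X = munit T X.
  have rKX : r X ∘ munit S (T X) = idc.
    exact: (congr1 (fun b : VNat T T => b X) rK).
  have -> : a X = r X ∘ umap S (munit T X) by [].
  by rewrite -compA -unit_natural compA rKX comp1f.
exists a; split=> // X.
(* both sides land in [T X], so they may be compared on the unit at [S X] *)
apply: (orthogonal_unique (free_orthogonal _ (ST _ _ _ (inverts_unit (S X))))).
have -> : (mmult T X ∘ (umap T (a X) ∘ a (S X))) ∘ munit S (S X)
    = mmult T X ∘ (umap T (a X) ∘ (a (S X) ∘ munit S (S X))).
  by rewrite !compA.
rewrite aU -unit_natural compA (mmult1l T X) comp1f.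
by rewrite -compA (mmult1l S X) compf1.
Qed.

(** Along a monad morphism [a] the unit of [S] at [T X] acquires the
    retraction [μ^T ∘ a_T]; thus [T X] is orthogonal to [Sigma_S]. *)
Lemma inverts_of_monad_morphism T (a : VNat S T) :
  is_monad_morphism a ->
  forall (X Y : B) (h : mor B X Y), inverts S h -> inverts T h.
Proof.
move=> [aU _]; apply: inverts_incl => X.
apply: (@split_unit_orthogonal S (T X) (mmult T X ∘ a (T X))).
by rewrite -compA aU; exact: mmult1l.
Qed.

Lemma idempotent_core_orthogonal T :
  idempotent_core T S <->
  forall X, associated_subcategory S X <-> orthogonal (@inverts V B B T) X.
Proof.
split=> [[_ ST] X | e].
- rewrite associated_orthogonal; split=> orth Y Z h Th; apply: orth.
    by apply/ST.
  by apply/ST.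
- split=> // X Y h; split.
  + apply: inverts_incl => Z; apply/associated_orthogonal/e; exact: free_orthogonal.
  + apply: inverts_incl => Z; apply/e; exact: unit_free_iso.
Qed.

End Idempotent.

Lemma idempotent_core_terminal T S :
  idempotent_core T S <-> terminal_idempotent T S /\ inverts_same S T.
Proof.
split=> [[idS ST] | [[idS _] ST]]; last by split.
split=> //; split=> //.
have S_T X Y (h : mor B X Y) : inverts S h -> inverts T h by move/ST.
have [i iM] := monad_morphism_exists idS S_T.
exists i; split=> // R a idR aM.
have R_T := inverts_of_monad_morphism aM.
have R_S X Y (h : mor B X Y) : inverts R h -> inverts S h by move/R_T/ST.
have [b bM] := monad_morphism_exists idR R_S.
exists b; split=> [|c [[cU _] _]].
- split=> //; apply: (monad_morphism_unique idR R_T) (proj1 aM) => X /=.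
  by move: (proj1 bM X) (proj1 iM X) => bU iU; rewrite -ucompA; move: bU => /= ->.
- exact: (monad_morphism_unique idR R_S) (proj1 bM) cU.
Qed.

End Monads.

(** * Idempotent monads and reflective subcategories *)

Section Reflections.
Variables (V : MonoidalCategory) (B : VCategory V).

Lemma umap_incl (P : B -> Prop) (X Y : full P) (f : mor (full P) X Y) :
  umap (incl P) f = f.
Proof. exact: (@comp1f V). Qed.

(** The monad is the one induced by the reflection.  As the inclusion is full,
    the unit at an object [Y] of the subcategory is itself a morphism of the
    subcategory, and naturality of the counit at it makes it inverse to the
    counit at [Y]. *)
Lemma idempotent_of_reflective (P : B -> Prop) :
  reflective P -> exists S : VMonad B,
    idempotent S /\ forall X, associated_subcategory S X <-> P X.
Proof.
move=> [repP [K [KJ]]]; exists (induced_monad KJ).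
pose e (Y : full P) : mor (full P) (K (proj1_sig Y)) Y := acounit KJ Y.
pose r (Y : full P) : mor (full P) Y (K (proj1_sig Y)) := aunit KJ (proj1_sig Y).
have er Y : e Y ∘ r Y = idc.
  by have := atriangleG KJ Y; rewrite /= umap_incl.
have re Y : r Y ∘ e Y = idc.
  have := vnat_umap (acounit KJ) (r Y).
  rewrite umap_comp [umap (vfun_id _) _](@comp1f V) umap_incl => <-.
  exact: (atriangleF KJ (proj1_sig Y)).
split.
- apply/idempotent_unitP => X.
  have -> : mmult (induced_monad KJ) X = umap (incl P) (e (K X)) by [].
  by rewrite umap_incl; exact: (re (K X)).
- move=> X; split=> [[u [uK Ku]] | PX].
  + apply: (repP _ X u _ (proj2_sig (K X))).
    by exists (aunit KJ X).
  + exists (e (exist P X PX)).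
    by split; [exact: (er (exist P X PX)) | exact: (re (exist P X PX))].
Qed.

(** The reflector is [S] corestricted, and the counit is the inverse of the unit
    of [S] on the subcategory.  The subcategory is given up to logical
    equivalence, so that [B_Sigma] itself can be taken for [P]. *)
Lemma reflective_of_idempotent (S : VMonad B) (P : B -> Prop) :
  idempotent S -> (forall X, associated_subcategory S X <-> P X) ->
  reflective P.
Proof.
move=> idS SP; split.
  move=> X Y f fI /SP uX; apply/SP; apply: (is_iso_of_comp_l fI).
  by rewrite unit_natural; apply: is_iso_comp uX; exact: umap_is_iso.
have PS X : P (S X) by apply/SP; exact: unit_free_iso.
pose K := corestriction PS.
have uP_nat (X Y : full P) :
    postcomp (proj1_sig X) (munit S (proj1_sig Y)) ∘ idc
    = precomp (S (proj1_sig Y)) (munit S (proj1_sig X)) ∘ (fmap S _ _ ∘ idc).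
  by rewrite (vnat_natural (munit S) (proj1_sig X)) compf1.
pose uP := @Build_VNat V (full P) (full P) (vfun_id (full P))
  (vfun_comp K (incl P)) (fun X => munit S (proj1_sig X)) uP_nat.
have uI X : is_iso (uP X) by apply/SP; exact: proj2_sig X.
have [c [cK Kc]] := vnat_inverse uI.
have cKX X : c X ∘ uP X = idc by exact: (congr1 (fun a : VNat _ _ => a X) cK).
have KcX X : uP X ∘ c X = idc by exact: (congr1 (fun a : VNat _ _ => a X) Kc).
have n X Y : postcomp X (munit S Y) ∘ idc
    = precomp (S Y) (munit S X) ∘ (idc ∘ fmap S X Y).
  by have := vnat_natural (munit S) X Y; rewrite comp1f.
exists K; constructor.
pose u := @Build_VNat V B B (vfun_id B) (vfun_comp (incl P) K) (munit S) n.
exists u c => [X|Y] /=.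
- have -> : umap K (munit S X) = munit S (S X) := umap_unit idS X.
  exact: cKX (K X).
- by rewrite umap_incl; exact: cKX Y.
Qed.

End Reflections.

(** * The adjunction inducing a monad *)

Section Adjunctions.
Variables (V : MonoidalCategory) (B C : VCategory V).
Variables (F : VFunctor B C) (G : VFunctor C B) (FG : VAdjunction F G).
Let T := induced_monad FG.

(** If [g] is inverse to [G F f], the transpose of [g ∘ η_Y] under the adjunction
    is inverse to [F f]. *)
Lemma induced_monad_inverts (X Y : B) (f : mor B X Y) :
  inverts T f <-> inverts F f.
Proof.
rewrite /inverts umap_comp; split; last exact: umap_is_iso.
move=> [g [gK Kg]].
pose e Z : mor C (F (G Z)) Z := acounit FG Z.
pose u Z : mor B Z (G (F Z)) := aunit FG Z.
have eN (Z W : C) (k : mor C Z W) : e W ∘ umap F (umap G k) = k ∘ e Z.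
  by have := vnat_umap (acounit FG) k;
     rewrite umap_comp [umap (vfun_id C) k](@comp1f V).
have uN (Z W : B) (k : mor B Z W) : u W ∘ k = umap G (umap F k) ∘ u Z.
  by rewrite -umap_comp; exact: (unit_natural T k).
have tF Z : e (F Z) ∘ umap F (u Z) = idc := atriangleF FG Z.
exists (e (F X) ∘ umap F g ∘ umap F (u Y)); split.
- rewrite -compA -umapM uN umapM !compA -(compA (e (F X))) -umapM gK umap1.
  by rewrite compf1 tF.
- by rewrite !compA -eN -(compA (e (F Y))) -umapM Kg umap1 compf1 tF.
Qed.

Lemma right_adjoint_orthogonal (Y : C) : orthogonal (@inverts V B B T) (G Y).
Proof. exact: (@split_unit_orthogonal V B T (G Y) _ (atriangleG FG Y)). Qed.

Lemma idempotent_core_factorization (S : VMonad B) (P : B -> Prop) :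
  idempotent S -> (forall X, associated_subcategory S X <-> P X) ->
  idempotent_core T S <->
  factors_through G P /\ conservative (induced_left F P).
Proof.
move=> idS SP; split=> [core | [GP consF]].
- have BS := proj1 (idempotent_core_orthogonal idS T) core.
  split=> [Y | X Y f Ff]; first by apply/SP/BS; exact: right_adjoint_orthogonal.
  have Sf : inverts S (f : mor B (proj1_sig X) (proj1_sig Y)).
    by apply/(proj2 core)/induced_monad_inverts; move: Ff;
       rewrite umap_comp umap_incl.
  have uX := proj2 (SP _) (proj2_sig X); have uY := proj2 (SP _) (proj2_sig Y).
  apply: (@is_iso_of_comp_r (underlying B) _ _ _ (munit S (proj1_sig Y)) f uY).
  by rewrite unit_natural; apply: is_iso_comp uX.
- have S_T X Y (f : mor B X Y) : inverts S f -> inverts T f.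
    apply: inverts_incl => Z; apply/associated_orthogonal => //.
    by apply/SP; exact: GP.
  split=> // X Y f; split; first exact: S_T.
  move=> /induced_monad_inverts Ff.
  have PS Z : P (S Z) by apply/SP; exact: unit_free_iso.
  have Fu Z : inverts F (munit S Z).
    by apply/induced_monad_inverts/S_T; exact: inverts_unit.
  apply: (consF (exist P (S X) (PS X)) (exist P (S Y) (PS Y)) (umap S f)).
  rewrite umap_comp umap_incl; apply: (is_iso_of_comp_l (Fu X)).
  by rewrite -umapM -unit_natural umapM; exact: (is_iso_comp (Fu Y) Ff).
Qed.

End Adjunctions.

(** * The characterization theorem *)

Theorem theorem4p15 (V : SMCC) (B C : VCategory V) (T : VMonad B)
    (F : VFunctor B C) (G : VFunctor C B) (FG : VAdjunction F G)
    (FG_induces_T : induced_monad FG = T) :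
  let core_exists :=
    exists S : VMonad B, idempotent_core T S in
  let terminal_exists :=
    exists S : VMonad B, terminal_idempotent T S /\ inverts_same S T in
  let orthogonal_reflective :=
    reflective (orthogonal (@inverts V B B T)) in
  let conservative_factorization :=
    exists P : B -> Prop,
      reflective P /\ factors_through G P /\ conservative (induced_left F P) in
  ((core_exists <-> terminal_exists) /\
   (terminal_exists <-> orthogonal_reflective) /\
   (orthogonal_reflective <-> conservative_factorization))
  /\
  (forall S : VMonad B, idempotent S ->
    let B' := associated_subcategory S in
    let cond_i := idempotent_core T S in
    let cond_ii := terminal_idempotent T S /\ inverts_same S T in
    let cond_iii := forall X : B, B' X <-> orthogonal (@inverts V B B T) X in
    let cond_iv := factors_through G B' /\ conservative (induced_left F B') in
    (cond_i <-> cond_ii) /\ (cond_ii <-> cond_iii) /\ (cond_iii <-> cond_iv)).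
Proof.
subst T; set T := induced_monad FG.
have core_reflective :
    (exists S, idempotent_core T S) <-> reflective (orthogonal (@inverts V B B T)).
  split=> [[S core] | /idempotent_of_reflective [S [idS SP]]].
  - have idS := proj1 core.
    by apply: (reflective_of_idempotent idS); apply/(idempotent_core_orthogonal idS).
  - by exists S; apply/(idempotent_core_orthogonal idS).
have core_factorization : (exists S, idempotent_core T S) <->
    exists P : B -> Prop,
      reflective P /\ factors_through G P /\ conservative (induced_left F P).
  split=> [[S core] | [P [/idempotent_of_reflective [S [idS SP]] fac]]].
  - have idS := proj1 core; exists (associated_subcategory S); split.
      exact: (reflective_of_idempotent idS).
    by apply/(idempotent_core_factorization FG idS).
  - by exists S; apply/(idempotent_core_factorization FG idS SP).
have core_terminal : (exists S, idempotent_core T S) <->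
    exists S, terminal_idempotent T S /\ inverts_same S T.
  by split=> [] [S /idempotent_core_terminal H]; exists S.
split; first by split=> //; split; [rewrite -core_terminal | rewrite -core_reflective].
move=> S idS; split; first exact: idempotent_core_terminal.
split.
- rewrite -(idempotent_core_orthogonal idS T); split=> /idempotent_core_terminal //.
- rewrite -(idempotent_core_orthogonal idS T).
  exact: (idempotent_core_factorization FG idS).
Qed.
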